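(* Let $X$ and $Y$ be two injective Banach spaces and let $\kappa$ be an infinite cardinal. Then: (1) If $X$ and $Y$ have the $\kappa$-Daugavet property, then $X\widehat{\otimes}_\pi Y$ has the $\kappa$-Daugavet property. (2) If $X$ and $Y$ have the $\kappa$-perfect Daugavet property, then $X\widehat{\otimes}_\pi Y$ has the $\kappa$-perfect Daugavet property.
   Context: All Banach spaces are real. A Banach space $X$ is injective if for all Banach spaces $Y\subseteq Z$ and every bounded linear operator $T:Y\to X$ there is a bounded linear extension $\hat T:Z\to X$ of $T$ with $\|\hat T\|=\|T\|$. $X\widehat{\otimes}_\pi Y$ is the projective tensor product: the completion of $X\otimes Y$ under $\|z\|_\pi=\inf\{\sum_{n=1}^k\|x_n\|\|y_n\|: z=\sum_{n=1}^k x_n\otimes y_n\}$. $B_X$ and $S_X$ denote the closed unit ball and unit sphere of $X$. A slice of $B_X$ is a nonempty intersection of $B_X$ with an open half-space, i.e. a set $\{x\in B_X: f(x)>\sup f(B_X)-\alpha\}$ with $f\in X^*$, $\alpha>0$. For a cardinal $\kappa$, $\{y_\alpha:\alpha<\kappa\}$ denotes a set of cardinality at most $\kappa$. $X$ has the $\kappa$-Daugavet property if for every family $\{y_\alpha:\alpha<\kappa\}\subseteq S_X$, every slice $S$ of $B_X$ and every $\varepsilon>0$ there is $x\in S$ with $\|y_\alpha+x\|>2-\varepsilon$ for all $\alpha<\kappa$. $X$ has the $\kappa$-perfect Daugavet property if for every family $\{y_\alpha:\alpha<\kappa\}\subseteq S_X$ and every slice $S$ of $B_X$ there is $x\in S$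 with $\|y_\alpha+x\|=2$ for all $\alpha<\kappa$. *)

(* Defs.v *)
From HB Require Import structures.
From mathcomp Require Import all_boot all_order all_algebra.
From mathcomp Require Import all_classical all_reals all_analysis.
Import Order.TTheory GRing.Theory Num.Theory.
Import numFieldNormedType.Exports.

Set Implicit Arguments.
Unset Strict Implicit.
Unset Printing Implicit Defensive.

Local Open Scope classical_set_scope.
Local Open Scope ring_scope.

Definition closed_unit_ball (R : realType) (X : normedModType R) : set X :=
  [set x | `|x| <= 1].

Definition unit_sphere (R : realType) (X : normedModType R) : set X :=
  [set x | `|x| = 1].

Definition op_norm (R : realType) (X Y : normedModType R)
    (f : {linear X -> Y}) : R :=
  sup [set `|f x| | x in @closed_unit_ball R X].

(* A Banach space Y contained in a Banach space Z is given by a linear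
   isometric embedding i : Y -> Z. *)
Definition injective_banach (R : realType) (X : completeNormedModType R) :
    Prop :=
  forall (Y Z : completeNormedModType R) (i : {linear Y -> Z}),
    (forall y, `|i y| = `|y|) ->
  forall T : {linear Y -> X}, continuous T ->
  exists T' : {linear Z -> X},
    [/\ continuous T', forall y, T' (i y) = T y & op_norm T' = op_norm T].

(* The slice {x in B_X : f x > sup f(B_X) - a}. *)
Definition slice (R : realType) (X : normedModType R) (f : {linear X -> R^o})
    (a : R) : set X :=
  [set x | closed_unit_ball x /\ sup (f @` @closed_unit_ball R X) - a < f x].

Definition is_slice (R : realType) (X : normedModType R) (S : set X) : Prop :=
  exists (f : {linear X -> R^o}) (a : R),
    [/\ continuous f, 0 < a & S = slice f a].

(* The cardinal kappa is the cardinality of the type K. *)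
Definition daugavet (K : Type) (R : realType) (X : normedModType R) : Prop :=
  forall A : set X, (A #<= [set: K])%card -> A `<=` @unit_sphere R X ->
  forall S : set X, is_slice S ->
  forall e : R, 0 < e ->
  exists2 x, S x & forall y, A y -> 2 - e < `|y + x|.

Definition perfect_daugavet (K : Type) (R : realType) (X : normedModType R) :
    Prop :=
  forall A : set X, (A #<= [set: K])%card -> A `<=` @unit_sphere R X ->
  forall S : set X, is_slice S ->
  exists2 x, S x & forall y, A y -> `|y + x| = 2.

Lemma lmod_separation (R : fieldType) (V : lmodType R) (v : V) :
  v != 0 -> exists f : {linear V -> R^o}, f v != 0.
Proof.
move=> v0.
pose sub (W : set V) := [/\ W 0, forall a u w, W u -> W w -> W (a *: u + w)
  & ~ W v].
pose P (W : set V) := W = set0 \/ sub W.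
have [W [PW maxW]] : exists W, P W /\ forall B, W `<` B -> ~ P B.
  apply: Zorn_bigcup => F FP tF.
  have [[W0 FW0 W00]|F0] := pselect (exists2 W, F W & W 0); last first.
    left; apply/seteqP; split => // x [W FW Wx]; exfalso; apply: F0.
    by exists W => //; have [E|[]//] := FP _ FW; rewrite E in Wx.
  right; split; first by exists W0.
    move=> a u w [A FA Au] [B FB Bw].
    have subF C x : F C -> C x -> sub C.
      by move=> FC Cx; have [E|//] := FP _ FC; rewrite E in Cx.
    have [AB|BA] := tF _ _ FA FB.
    + exists B => //; have [_ + _] := subF _ _ FB Bw.
      by apply => //; apply: AB.
    + exists A => //; have [_ + _] := subF _ _ FA Au.
      by apply => //; apply: BA.
  move=> [A FA Av]; have [E|[]//] := FP _ FA; by rewrite E in Av.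
have [W0 WD Wv] : sub W.
  case: PW => // E; exfalso; apply: (maxW [set 0]).
    rewrite E; split; first exact: sub0set.
    by move=> /(_ 0); apply.
  right; split => //=; first by move=> a u w -> ->; rewrite scaler0 addr0.
  by move/eqP; rewrite (negbTE v0).
have WZ a u : W u -> W (a *: u) by move=> Wu; rewrite -[_ *: _]addr0; apply: WD.
have WN u w : W u -> W w -> W (u - w).
  by move=> Wu Ww; rewrite addrC -scaleN1r; apply: WD.
have ex u : exists c : R, W (u - c *: v).
  have [Wu|nWu] := pselect (W u); first by exists 0; rewrite scale0r subr0.
  pose B := [set x | exists a, W (x - a *: u)].
  have WB : W `<` B.
    split; first by move=> x Wx; exists 0; rewrite scale0r subr0.
    by move=> BW; apply: nWu; apply: BW; exists 1; rewrite scale1r subrr.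
  have : ~ sub B by move=> sB; apply: (maxW _ WB); right.
  move=> nsB; have [[a Wa]|nBv] := pselect (B v); last first.
    exfalso; apply: nsB; split => //.
      by exists 0; rewrite scale0r subr0.
    move=> a x y [c Wc] [d Wd]; exists (a * c + d).
    rewrite (_ : _ - _ = a *: (x - c *: u) + (y - d *: u)); first exact: WD.
    by rewrite scalerDl -scalerA scalerBr opprD addrACA.
  have a0 : a != 0.
    by apply/eqP => a0; apply: Wv; move: Wa; rewrite a0 scale0r subr0.
  exists a^-1; have := WZ (- a^-1) _ Wa.
  by rewrite scalerBr scalerA mulNr mulVf// !scaleNr scale1r opprK addrC.
pose f u : R^o := projT1 (cid (ex u)).
have fP u : W (u - f u *: v) by rewrite /f; case: cid.
have uniq u c d : W (u - c *: v) -> W (u - d *: v) -> c = d.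
  move=> Wc Wd; apply/eqP; rewrite -subr_eq0; apply/negP => /negP cd.
  apply: Wv; have := WZ (c - d)^-1 _ (WN _ _ Wd Wc).
  rewrite (_ : _ - _ - _ = (c - d) *: v); first by rewrite scalerK.
  by rewrite scalerBl opprB addrC addrA subrK.
have flin : linear f.
  move=> a u w; apply: (uniq (a *: u + w)) => //.
  rewrite (_ : _ - _ = a *: (u - f u *: v) + (w - f w *: v)); first exact: WD.
  by rewrite scalerDl -scalerA scalerBr opprD addrACA.
pose F : {linear V -> R^o} := HB.pack f (GRing.isLinear.Build _ _ _ _ f flin).
exists F => /=.
by apply/eqP => fv; apply: Wv; have := fP v; rewrite fv scale0r subr0.
Qed.

(* The algebraic tensor product of X and Y is realised, as in Ryan's
   "Introduction to Tensor Products of Banach Spaces", as the space of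
   functionals on the bilinear forms on X x Y that is spanned by the
   evaluations x (x) y : b |-> b x y.  The lemma tensor_universal below shows
   that this space has the universal property of the tensor product. *)
Section Tensor.
Context (R : realType) (X Y : lmodType R).

Definition evalb (x : X) (y : Y) : {bilinear X -> Y -> R^o} -> R^o :=
  fun b => b x y.

Definition tensor_pred : {pred {bilinear X -> Y -> R^o} -> R^o} :=
  [pred phi | `[< exists s : seq (X * Y),
                    phi = \sum_(p <- s) evalb p.1 p.2 >] ].

Lemma tensor_submod_closed : submod_closed tensor_pred.
Proof.
split; first by apply/asboolP; exists [::]; rewrite big_nil.
move=> c _ _ /asboolP[s ->] /asboolP[t ->]; apply/asboolP.
exists ([seq (c *: p.1, p.2) | p <- s] ++ t).
rewrite big_cat big_map scaler_sumr; congr (_ + _).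
by apply: eq_bigr => p _; apply/funext => b; rewrite /evalb/= linearZl_LR.
Qed.

HB.instance Definition _ := GRing.isSubmodClosed.Build R
  ({bilinear X -> Y -> R^o} -> R^o) tensor_pred tensor_submod_closed.

Record tensor := Tensor {
  tensor_val :> {bilinear X -> Y -> R^o} -> R^o ;
  _ : tensor_val \in tensor_pred }.

HB.instance Definition _ := [isSub for tensor_val].
HB.instance Definition _ := [Choice of tensor by <:].
HB.instance Definition _ := [SubChoice_isSubLmodule of tensor by <:].

Lemma evalb_tensor (x : X) (y : Y) : evalb x y \in tensor_pred.
Proof. by apply/asboolP; exists [:: (x, y)]; rewrite big_seq1. Qed.

Definition pure (x : X) (y : Y) : tensor := Tensor (evalb_tensor x y).

Lemma tensorP (z : tensor) :
  exists s : seq (X * Y), z = \sum_(p <- s) pure p.1 p.2.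
Proof.
case: z => phi phiT; have /asboolP[s phiE] := phiT; exists s.
by apply/val_inj; rewrite raddf_sum.
Qed.

Lemma sum_pure_eq0 (V : lmodType R) (b : {bilinear X -> Y -> V})
    (s : seq (X * Y)) :
  \sum_(p <- s) pure p.1 p.2 = 0 -> \sum_(p <- s) b p.1 p.2 = 0.
Proof.
move=> s0; apply/eqP; apply/negP => /negP /lmod_separation[f].
pose fb x y : R^o := f (b x y).
have fbP : bilinear_for *:%R *:%R fb.
  split=> u a x y; rewrite /fb; first by rewrite linearPl linearP.
  by rewrite linearPr linearP.
pose B : {bilinear X -> Y -> R^o} := HB.pack fb
  (bilinear_isBilinear.Build _ _ _ _ _ _ fb fbP).
move/negP; apply; apply/eqP.
have /(congr1 (fun z : tensor => val z B)) := s0.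
by rewrite !raddf_sum fct_sumE.
Qed.

Lemma tensor_universal (V : lmodType R) (b : {bilinear X -> Y -> V}) :
  exists2 g : {linear tensor -> V}, (forall x y, g (pure x y) = b x y) &
  forall g' : {linear tensor -> V},
    (forall x y, g' (pure x y) = b x y) -> g' =1 g.
Proof.
pose g z := \sum_(p <- projT1 (cid (tensorP z))) b p.1 p.2.
have gE s : g (\sum_(p <- s) pure p.1 p.2) = \sum_(p <- s) b p.1 p.2.
  rewrite /g; case: cid => t /= tE; apply/eqP; rewrite eq_sym -subr_eq0.
  pose t' := [seq (- p.1, p.2) | p <- t].
  have -> : \sum_(p <- s) b p.1 p.2 - \sum_(p <- t) b p.1 p.2 =
      \sum_(p <- s ++ t') b p.1 p.2.
    rewrite big_cat big_map/= -sumrN; congr (_ + _).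
    by apply: eq_bigr => p _; rewrite linearNl.
  apply/eqP/sum_pure_eq0; rewrite big_cat big_map/= tE -big_split/=.
  apply: big1 => p _; apply/val_inj; rewrite raddfD/=.
  by apply/funext => B; rewrite /= /evalb !fctE linearNl subrr.
have glin : linear g.
  move=> a z w; have [s ->] := tensorP z; have [t ->] := tensorP w.
  have -> : a *: \sum_(p <- s) pure p.1 p.2 + \sum_(p <- t) pure p.1 p.2 =
      \sum_(p <- [seq (a *: p.1, p.2) | p <- s] ++ t) pure p.1 p.2.
    rewrite big_cat big_map scaler_sumr; congr (_ + _).
    apply: eq_bigr => p _; apply/val_inj/funext => B.
    by rewrite linearZ/= /evalb/= linearZl_LR.
  rewrite !gE big_cat big_map scaler_sumr; congr (_ + _).
  by apply: eq_bigr => p _; rewrite linearZl_LR.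
pose G : {linear tensor -> V} := HB.pack g
  (GRing.isLinear.Build _ _ _ _ g glin).
exists G => /= [x y|g' g'E z].
  by have := gE [:: (x, y)]; rewrite !big_seq1.
have [s ->] := tensorP z; rewrite gE raddf_sum.
by apply: eq_bigr => p _; exact: g'E.
Qed.

End Tensor.

Definition pi_norm (R : realType) (X Y : normedModType R) (z : tensor X Y) :
    R :=
  inf [set r | exists2 s : seq (X * Y),
         z = \sum_(p <- s) pure p.1 p.2 & r = \sum_(p <- s) `|p.1| * `|p.2|].

(* P, with the canonical map j, is the completion of (tensor X Y, pi_norm);
   it is thereby determined up to isometric isomorphism. *)
Definition is_projective_tensor (R : realType) (X Y : normedModType R)
    (P : completeNormedModType R) (j : {linear tensor X Y -> P}) : Prop :=
  (forall z, `|j z| = pi_norm z) /\ dense (range j).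

(* Main.v *)
Require Import Defs.
From HB Require Import structures.
From mathcomp Require Import all_boot all_order all_algebra.
From mathcomp Require Import all_classical all_reals all_analysis.
From mathcomp Require Import lra.
Import Order.TTheory GRing.Theory Num.Theory.
Import numFieldNormedType.Exports.

Set Implicit Arguments.
Unset Strict Implicit.
Unset Printing Implicit Defensive.

Local Open Scope classical_set_scope.
Local Open Scope ring_scope.

(* Write c = 1 - e, with e = 0 in the perfect case.  Every z in P is a limit of
   sums of pure tensors, so it only involves separable subspaces E_z of X and
   F_z of Y; as K is infinite, the family A thus gives at most K unit vectors
   of X (of Y) whose rational directions are dense in all the E_z (F_z).  A
   slice of B_P contains some x0 (x) y0; the hypothesis on X, in the slice cut
   out by _ (x) y0, gives u almost l1-orthogonal to every E_z, and then that on
   Y, in the slice cut out by u (x) _, gives v likewise for every F_z.  By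
   injectivity, for all x, y in the unit balls there are contractions T, S of
   X, Y with T = c on E_z, T u = c x, S = c on F_z, S v = c y; applying
   T (x) S yields |z + u (x) v| >= c^2 |z + x (x) y|.  Averaging over x (x) y
   in a nearly optimal representation of z bounds this below by 2 c^2. *)

(** * Cardinal arithmetic: countably many vectors per index *)

Section CountableFamilies.
Context (K : pointedType).

(** The case [s = t] makes every member injective. *)
Definition disjoint_sequences (S : set (nat -> K)) :=
  forall s t m n, S s -> S t -> s m = t n -> s = t /\ m = n.

(* A maximal family S of disjoint injective sequences covers all of K but a
   finite set, so that K is equipotent to S * nat. *)
Lemma card_setM_nat (infK : infinite_set [set: K]) :
  ([set: K * nat] #<= [set: K])%card.
Proof.
have [S [Sd Smax]] : exists S, disjoint_sequences S /\
    forall B, S `<` B -> ~ disjoint_sequences B.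
  apply: Zorn_bigcup => F Fd Ft s t m n [A FA As] [B FB Bt].
  have [AB|BA] := Ft _ _ FA FB.
    by apply: (Fd _ FB) => //; apply: AB.
  by apply: (Fd _ FA) => //; apply: BA.
pose U := [set k | exists s n, S s /\ s n = k].
have finU : finite_set (~` U).
  apply: contrapT => /infiniteP/pcard_leP[/= f];
    apply: (Smax (S `|` [set (f : nat -> K)])).
    split; first by move=> s; left.
    move=> /(_ f (or_intror erefl)) Sf.
    by case: (@funS _ _ _ _ f 0%N I); exists f, 0%N.
  have fU n : ~ U (f n) by exact: (@funS _ _ _ _ f n I).
  have finj m n : f m = f n -> m = n by move=> /(@inj _ _ _ f); apply;
    rewrite inE.
  move=> s t m n [Ss|->] [St|->]; first exact: Sd.
  - by move=> E; case: (fU n); exists s, m.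
  - by move=> E; case: (fU m); exists t, n.
  - by move=> /finj.
have [k0 Uk0] : U !=set0.
  apply/set0P/eqP => U0; apply: infK; rewrite -[setT]setC0 -U0; exact: finU.
have [s0 [n0 [Ss0 _]]] := Uk0.
have [g ginj] : exists g : K -> nat, {in ~` U &, injective g}.
  by apply/countable_injP; exact: finite_set_countable.
(* The pair [p] determines [k]: for even [p.2], [k] is a term of [p.1]; an odd [p.2] encodes the
   number [g k] of an uncovered [k]. *)
have ex k : exists p : (nat -> K) * nat, S p.1 /\
    (U k /\ p.1 (p.2)./2 = k /\ ~~ odd p.2 \/ ~ U k /\ odd p.2 /\
      (p.2)./2 = g k).
  have [[s [n [Ss sn]]]|nU] := pselect (U k).
    exists (s, n.*2); split => //; left; split; first by exists s, n.
    by rewrite /= odd_double doubleK.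
  by exists (s0, (g k).*2.+1); split => //; right;
    rewrite /= odd_double uphalf_double.
pose h k := projT1 (cid (ex k)).
have hS k : S (h k).1 by rewrite /h; case: cid => p [].
have hinj : injective h.
  move=> k l kl; have : h k = h k by [].
  rewrite {2}kl {1 2}/h; do 2 case: cid.
  move=> p /= [_ pk] q [_ qk] pq; move: pk qk; rewrite pq.
  case=> [[Uk [Ek ke]]|[nUk [ko pg]]]; case=> [[Ul [El le]]|[nUl [lo qg]]].
  - by rewrite -Ek -El.
  - by rewrite lo in ke.
  - by rewrite ko in le.
  - by apply: ginj; rewrite ?inE// -pg -qg.
apply/pcard_injP.
(* The image of [(k, m)] is a term of the sequence [(h k).1] itself, so disjointness recovers both
   [h k] and [m]. *)
exists (fun p => (h p.1).1 (pickle ((h p.1).2, p.2))).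
move=> [k m] [l n] _ _ /= hkl.
have [E /(pcan_inj pickleK)[E2 ->]] := Sd _ _ _ _ (hS _) (hS _) hkl.
congr (_, _); apply: hinj.
by move: E E2; case: (h k) => ? ?; case: (h l) => ? ? /= -> ->.
Qed.

End CountableFamilies.

(** Each value [f a n] is coded by one pair [(g a, n)], with [g] injecting [A] into [K]; an infinite
    [K] absorbs the factor [nat]. *)
Lemma card_le_image2_nat (K T U : Type) (infK : infinite_set [set: K])
    (A : set T) (f : T -> nat -> U) : (A #<= [set: K])%card ->
  ([set u | exists2 a, A a & exists n, u = f a n] #<= [set: K])%card.
Proof.
have [k0 _] := infinite_setN0 infK.
pose K' : pointedType := HB.pack {classic K} (isPointed.Build {classic K} k0).
move=> /(@pcard_injP _ K')[g ginj].
apply: card_le_trans (@card_setM_nat K' infK).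
have ex u : exists p : K' * nat, (exists2 a, A a & exists n, u = f a n) ->
    exists a, [/\ A a, p.1 = g a & u = f a p.2].
  have [[a Aa [n ->]]|nu] := pselect (exists2 a, A a & exists n, u = f a n).
    by exists (g a, n) => _; exists a.
  by exists (k0, 0%N).
have [h hP] := choice ex.
apply/pcard_injP; exists h => u v; rewrite !inE.
move=> /hP[a [Aa ha ua]] /hP[b [Ab hb vb]] huv.
have ab : a = b by apply: ginj; rewrite ?inE// -ha -hb huv.
by rewrite ua vb ab huv.
Qed.

(** * The Banach space of a contractive relation *)

(* The closure of (the graph of) a contractive relation, normed by the first
   component, is a Banach space with an isometric embedding graph_fst;
   injectivity applied to graph_snd extends the relation without first
   extending it to the closure of its domain. *)
Record contractive_relation (R : realType) (X Z : normedModType R) := CRel {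
  crel : set (X * Z);
  crel0 : crel 0;
  crelP : forall a p q, crel p -> crel q -> crel (a *: p + q);
  crel_le : forall p, crel p -> `|p.2| <= `|p.1| }.

Section GraphClosure.
Context (R : realType) (X Z : normedModType R) (G : contractive_relation X Z).

Definition graph_closure : {pred X * Z} := [pred p | `[< forall e, 0 < e ->
  exists2 q, crel G q & `|p.1 - q.1| < e /\ `|p.2 - q.2| < e >] ].

Lemma graph_closure_le p : p \in graph_closure -> `|p.2| <= `|p.1|.
Proof.
move=> /asboolP pG; apply/ler_addgt0Pr => e e0.
have [q Gq [pq1 pq2]] := pG (e / 2) (divr_gt0 e0 (ltr0n _ 2)).
have := crel_le Gq.
have := ler_normD (p.2 - q.2) q.2; rewrite subrK.
have := ler_normD (q.1 - p.1) p.1; rewrite subrK distrC.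
lra.
Qed.

Lemma graph_closure_submod : submod_closed graph_closure.
Proof.
split=> [|a p q /asboolP pG /asboolP qG]; apply/asboolP => e e0.
  by exists 0; [exact: crel0|rewrite !subrr !normr0].
have d0 : 0 < e / 2 / (1 + `|a|) by rewrite !divr_gt0// ltr_pwDl.
have [p' Gp' [p1 p2]] := pG _ d0.
have [q' Gq' [q1 q2]] := qG _ (divr_gt0 e0 (ltr0n _ 2)).
exists (a *: p' + q'); first exact: crelP.
have bd (V : normedModType R) (u v u' v' : V) :
    `|u - u'| < e / 2 / (1 + `|a|) -> `|v - v'| < e / 2 ->
    `|a *: u + v - (a *: u' + v')| < e.
  rewrite ltr_pdivlMr ?ltr_pwDl// => uu vv.
  rewrite opprD addrACA -scalerBr; apply: (le_lt_trans (ler_normD _ _)).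
  rewrite normrZ; have := normr_ge0 (u - u'); nra.
by split; apply: bd.
Qed.

HB.instance Definition _ := GRing.isSubmodClosed.Build R
  (X * Z)%type graph_closure graph_closure_submod.

Record graph := Graph { graph_val :> X * Z ; _ : graph_val \in graph_closure }.

HB.instance Definition _ := [isSub for graph_val].
HB.instance Definition _ := [Choice of graph by <:].
HB.instance Definition _ := [SubChoice_isSubLmodule of graph by <:].

Definition graph_norm (p : graph) : R := `|(val p).1|.

Lemma graph_normD p q : graph_norm (p + q) <= graph_norm p + graph_norm q.
Proof. by rewrite /graph_norm raddfD ler_normD. Qed.

Lemma graph_normZ a p : graph_norm (a *: p) = `|a| * graph_norm p.
Proof. by rewrite /graph_norm linearZ normrZ. Qed.

(** Contractivity passes to the closure, so a zero first component forces a zero second one. *)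
Lemma graph_norm_eq0 p : graph_norm p = 0 -> p = 0.
Proof.
move=> p0; apply/val_inj; rewrite raddf0.
have /eqP : `|(val p).1| = 0 by [].
have := graph_closure_le (valP p); rewrite [X in _ <= X]p0 normr_le0 normr_eq0.
by case: (val p) => a b /= /eqP-> /eqP->.
Qed.

HB.instance Definition _ := Lmodule_isNormed.Build R graph
  graph_normD graph_normZ graph_norm_eq0.

Definition graph_fst (p : graph) : X := (val p).1.
Definition graph_snd (p : graph) : Z := (val p).2.

Lemma graph_fst_linear : linear graph_fst.
Proof. by move=> a p q; rewrite /graph_fst raddfD linearZ. Qed.

Lemma graph_snd_linear : linear graph_snd.
Proof. by move=> a p q; rewrite /graph_snd raddfD linearZ. Qed.

HB.instance Definition _ :=
  GRing.isLinear.Build R graph X *:%R graph_fst graph_fst_linear.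
HB.instance Definition _ :=
  GRing.isLinear.Build R graph Z *:%R graph_snd graph_snd_linear.

Lemma norm_graph_fst p : `|graph_fst p| = `|p|.
Proof. by []. Qed.

Lemma norm_graph_snd p : `|graph_snd p| <= `|p|.
Proof. exact: graph_closure_le (valP p). Qed.

End GraphClosure.

Section GraphComplete.
Context (R : realType) (X Z : completeNormedModType R).
Context (G : contractive_relation X Z).

(** Both projections are contractive, so they converge along [F]; the pair of limits stays in the
    closure, and the norm sees only the first component. *)
Lemma graph_complete (F : set_system (graph G)) :
  ProperFilter F -> cauchy F -> cvg F.
Proof.
move=> FF /cauchy_ballP Fc.
have cF (W : completeNormedModType R) (f : {linear graph G -> W}) :
    (forall p, `|f p| <= `|p|) -> cvg (f @ F).
  move=> fle; apply: cauchy_cvg; apply/cauchy_ballP => e e0.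
  have := Fc e e0 => -[[A B] [/= FA FB] AB].
  exists (f @` A, f @` B).
    by split => /=; [apply: filterS FA|apply: filterS FB] => p ?; exists p.
  move=> [_ _] [[p Ap <-] [q Bq <-]] /=.
  have := AB (p, q) (conj Ap Bq); rewrite -!ball_normE/= -raddfB => pq.
  exact: le_lt_trans (fle _) pq.
have c1 := cF _ (@graph_fst _ _ _ G) (fun p => lexx _).
have c2 := cF _ (@graph_snd _ _ _ G) (@norm_graph_snd _ _ _ G).
set l1 := lim _ in c1; set l2 := lim _ in c2.
have near1 e : 0 < e -> \forall p \near F, `|l1 - graph_fst p| < e.
  by move=> e0; move/cvgrPdist_lt: c1; apply.
have near2 e : 0 < e -> \forall p \near F, `|l2 - graph_snd p| < e.
  by move=> e0; move/cvgrPdist_lt: c2; apply.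
have lG : (l1, l2) \in graph_closure G.
  apply/asboolP => e e0.
  have e2 : 0 < e / 2 by rewrite divr_gt0.
  have [p [p1 p2]] := filter_ex (filterI (near1 _ e2) (near2 _ e2)).
  have /asboolP/(_ _ e2)[q Gq [q1 q2]] := valP p.
  exists q => //=; split.
    have := ler_normD (l1 - (val p).1) ((val p).1 - q.1); rewrite addrA subrK.
    move: p1 q1; rewrite /graph_fst; lra.
  have := ler_normD (l2 - (val p).2) ((val p).2 - q.2); rewrite addrA subrK.
  move: p2 q2; rewrite /graph_snd; lra.
apply/cvg_ex; exists (Graph lG).
by apply/fcvgrPdist_lt => e /near1.
Qed.

HB.instance Definition _ :=
  Uniform_isComplete.Build (graph G) graph_complete.

End GraphComplete.

(** * Operator norms and extension by injectivity *)

Lemma op_norm_le1 (R : realType) (X Y : normedModType R) (f : {linear X -> Y}) :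
  (forall x, `|f x| <= `|x|) -> op_norm f <= 1.
Proof.
move=> fle; apply: ge_sup; last first.
  by move=> _ [x /= x1 <-]; apply: le_trans x1.
by exists 0, 0; rewrite /closed_unit_ball/= ?linear0 ?normr0.
Qed.

Lemma continuous_linear_bound (R : realType) (X Y : normedModType R)
    (f : {linear X -> Y}) :
  continuous f -> exists2 M, 0 < M & forall x, `|f x| <= M * `|x|.
Proof.
move=> /(_ 0)/continuous_linear_bounded/linear_boundedP[M [Mr fM]].
exists (Num.max M 0 + 1); first by rewrite ltr_pwDr// le_max lexx orbT.
by apply: fM; rewrite (@le_lt_trans _ _ (Num.max M 0))// ?ltrDl// le_max lexx.
Qed.

Lemma le_op_norm (R : realType) (X Y : normedModType R) (f : {linear X -> Y})
    (x : X) : continuous f -> `|f x| <= op_norm f * `|x|.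
Proof.
move=> /continuous_linear_bound[M M0 fM].
have [->|x0] := eqVneq x 0; first by rewrite linear0 !normr0 mulr0.
have nx : 0 < `|x| by rewrite normr_gt0.
rewrite -ler_pdivrMr// mulrC -[X in X * _]gtr0_norm ?invr_gt0//.
rewrite -normrZ -linearZ; apply: ub_le_sup.
  exists M => _ [y /= y1 <-]; apply: le_trans (fM y) _.
  by rewrite -[leRHS]mulr1 ler_wpM2l// ltW.
exists (`|x|^-1 *: x) => //.
by rewrite /closed_unit_ball/= normrZ gtr0_norm ?invr_gt0// mulVf// gt_eqF.
Qed.

(** Injectivity extends [graph_snd] along the isometric embedding [graph_fst] with the same norm,
    which is at most 1. *)
Lemma injective_extension (R : realType) (X : completeNormedModType R)
    (injX : injective_banach X) (Z : completeNormedModType R)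
    (G : contractive_relation Z X) :
  exists T : {linear Z -> X},
    (forall z, `|T z| <= `|z|) /\ forall p, crel G p -> T p.1 = p.2.
Proof.
have sc : continuous (@graph_snd _ _ _ G).
  apply/bounded_linear_continuous/linear_boundedP; exists 1; split => // M M1 p.
  apply: le_trans (norm_graph_snd p) _.
  by rewrite ler_peMl// ltW.
have [T [Tc TE Tn]] :=
  injX _ _ (@graph_fst _ _ _ G) (@norm_graph_fst _ _ _ G) _ sc.
exists T; split => [z|p Gp].
  apply: le_trans (le_op_norm z Tc) _; rewrite Tn ler_piMl//.
  exact: op_norm_le1 (@norm_graph_snd _ _ _ _).
have pG : p \in graph_closure G.
  by apply/asboolP => e e0; exists p => //; rewrite !subrr !normr0.
exact: TE (Graph pG).
Qed.

(** * Almost l1-orthogonality to a separable subspace *)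

Lemma norm_normalize (R : realType) (X : normedModType R) (x : X) :
  x != 0 -> `| `|x|^-1 *: x| = 1.
Proof. by move=> x0; rewrite normrZV// unitfE normr_eq0. Qed.

Section RationalSpan.
Context (R : realType) (X : normedModType R) (g : nat -> X).

Definition rat_comb (l : seq (rat * nat)) : X :=
  \sum_(p <- l) ratr p.1 *: g p.2.

(** Rational coefficients leave only countably many combinations, yet the closure is a real
    subspace. *)
Definition rat_span_closure : set X :=
  [set x | forall e, 0 < e -> exists l, `|x - rat_comb l| < e].

Lemma rat_combZ q l :
  rat_comb [seq (q * p.1, p.2) | p <- l] = ratr q *: rat_comb l.
Proof.
rewrite /rat_comb big_map scaler_sumr; apply: eq_bigr => p _ /=.
by rewrite scalerA rmorphM.
Qed.

Lemma rat_comb_cat l m : rat_comb (l ++ m) = rat_comb l + rat_comb m.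
Proof. by rewrite /rat_comb big_cat. Qed.

Lemma rat_span_closure_gen i : rat_span_closure (g i).
Proof.
move=> e e0; exists [:: (1, i)].
by rewrite /rat_comb big_seq1 /= rmorph1 scale1r subrr normr0.
Qed.

Lemma rat_span_closure0 : rat_span_closure 0.
Proof. by move=> e e0; exists [::]; rewrite /rat_comb big_nil subr0 normr0. Qed.

Lemma rat_span_closureP a x y : rat_span_closure x -> rat_span_closure y ->
  rat_span_closure (a *: x + y).
Proof.
move=> xE yE e e0; have e3 : 0 < e / 3 by rewrite divr_gt0.
have a0 : 0 < 1 + `|a| by rewrite ltr_pwDl.
have [l xl] := xE _ (divr_gt0 e3 a0).
have [m ym] := yE _ e3.
set d := rat_comb l in xl; have d0 : 0 < 1 + `|d| by rewrite ltr_pwDl.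
have [q /itvP aq] : exists q : rat, ratr q \in `]a, (a + e / 3 / (1 + `|d|))[.
  by apply: rat_in_itvoo; rewrite ltrDl divr_gt0.
have {aq} : `|a - ratr q| < e / 3 / (1 + `|d|).
  rewrite distrC gtr0_norm ?subr_gt0 ?aq//.
  by rewrite ltrBlDl aq.
move: xl; rewrite !ltr_pdivlMr// => xl aq.
exists ([seq (q * p.1, p.2) | p <- l] ++ m); rewrite rat_comb_cat rat_combZ -/d.
have -> : a *: x + y - (ratr q *: d + rat_comb m) =
    a *: (x - d) + (a - ratr q) *: d + (y - rat_comb m).
  by rewrite scalerBr scalerBl (addrA (a *: x - a *: d)) subrK opprD addrACA.
have := ler_normD (a *: (x - d) + (a - ratr q) *: d) (y - rat_comb m).
have := ler_normD (a *: (x - d)) ((a - ratr q) *: d).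
rewrite !normrZ.
have := normr_ge0 (x - d); have := normr_ge0 (a - ratr q).
nra.
Qed.

Context (u : X) (e : R) (e0 : 0 <= e) (e1 : e <= 1) (u1 : `|u| <= 1).
Context (g0 : exists i, g i != 0).
Context (far : forall l, rat_comb l != 0 ->
  2 - e <= `| `|rat_comb l|^-1 *: rat_comb l + u|).

(** One normalized nonzero generator suffices; this covers combinations equal to 0. *)
Lemma far_norm : 1 - e <= `|u|.
Proof.
have [i gi] := g0.
have gE : rat_comb [:: (1, i)] = g i.
  by rewrite /rat_comb big_seq1 /= rmorph1 scale1r.
have := @far [:: (1, i)]; rewrite gE => /(_ gi).
have := ler_normD (`|g i|^-1 *: g i) u.
by rewrite norm_normalize//; lra.
Qed.

(** For a combination [d] of direction [y], subtract from [max(|d|, t) (y + u)] the surplus multiple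
    of [u] or [y]; the loss [e max(|d|, t)] is at most [e (|d| + t)]. *)
Lemma far_rat_comb l t : 0 <= t ->
  (1 - e) * (`|rat_comb l| + t) <= `|rat_comb l + t *: u|.
Proof.
move=> t0; have [->|d0] := eqVneq (rat_comb l) 0.
  rewrite normr0 !add0r normrZ ger0_norm// mulrC.
  by rewrite ler_wpM2l// far_norm.
have := far d0; set d := rat_comb l in d0 *; set y := _ *: d => yu.
have nd : 0 < `|d| by rewrite normr_gt0.
have ny : `|y| = 1 by exact: norm_normalize.
have dE : d = `|d| *: y by rewrite /y scalerA divff ?scale1r// gt_eqF.
clearbody y; have [td|/ltW dt] := leP t `|d|.
  have -> : d + t *: u = `|d| *: (y + u) - (`|d| - t) *: u.
    by rewrite scalerDr -dE scalerBl opprB -addrA [X in _ = _ + X]addrC subrK.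
  have := lerB_normD (`|d| *: (y + u)) (- ((`|d| - t) *: u)).
  rewrite normrN !normrZ (ger0_norm (ltW nd)) (@ger0_norm _
    (`|d| - t)) ?subr_ge0// => h.
  have h1 : `|d| * (2 - e) <= `|d| * `|y + u| by rewrite ler_wpM2l// ltW.
  have h2 : (`|d| - t) * `|u| <= `|d| - t by rewrite ler_piMr// subr_ge0.
  have h3 : 0 <= e * t by rewrite mulr_ge0.
  lra.
have -> : d + t *: u = t *: (y + u) - (t - `|d|) *: y.
  by rewrite scalerDr scalerBl -dE opprB [RHS]addrC addrA subrK.
have := lerB_normD (t *: (y + u)) (- ((t - `|d|) *: y)).
rewrite normrN !normrZ ny (ger0_norm t0) (@ger0_norm _
  (t - `|d|)) ?subr_ge0// mulr1 => h.
have h1 : t * (2 - e) <= t * `|y + u| by rewrite ler_wpM2l.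
have h3 : 0 <= e * `|d| by rewrite mulr_ge0.
lra.
Qed.

Lemma far_rat_span_closure x t : rat_span_closure x ->
  (1 - e) * (`|x| + `|t|) <= `|x + t *: u|.
Proof.
move=> xE; apply/ler_addgt0Pr => d d0.
have [l xl] := xE _ (divr_gt0 d0 (ltr0n _ 2)).
have : (1 - e) * (`|rat_comb l| + `|t|) <= `|rat_comb l + t *: u|.
  have [t0|/ltW t0] := leP 0 t; first by rewrite (ger0_norm t0) far_rat_comb.
  have Nl : rat_comb [seq (-1 * p.1, p.2) | p <- l] = - rat_comb l.
    by rewrite rat_combZ rmorphN1 scaleN1r.
  have := @far_rat_comb [seq (-1 * p.1, p.2) | p <- l] (- t).
  rewrite oppr_ge0 Nl normrN scaleNr -opprD normrN ler0_norm//; exact.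
have := ler_normD (x - rat_comb l) (rat_comb l); rewrite subrK.
have := ler_normD (rat_comb l - x) (x + t *: u);
  rewrite addrA subrK (distrC _ x).
move=> h1 h2 h3.
have h4 : (1 - e) * (`|x| + `|t|) <= (1 - e) * (`|rat_comb l| + `|t|) + d / 2.
  rewrite -lerBlDl -mulrBr; apply: le_trans (_ : `|x - rat_comb l| <= _);
    last exact: ltW.
  rewrite (le_trans (_ : _ <= (1 - e) * `|x - rat_comb l|))//.
    by rewrite ler_wpM2l ?subr_ge0//; lra.
  by rewrite ler_piMl// gerBl.
lra.
Qed.

End RationalSpan.

(** Relate [v + t u] to [(1 - e) (v + t x)] for [v] in the closed span. The lower bound on
    [|v + t u|] makes this contractive, hence extendable. *)
Lemma l1_extension (R : realType) (X : completeNormedModType R)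
    (injX : injective_banach X) (g : nat -> X) (u : X) (e : R) :
  0 <= e -> e <= 1 -> `|u| <= 1 -> (exists i, g i != 0) ->
  (forall l, rat_comb g l != 0 ->
    2 - e <= `| `|rat_comb g l|^-1 *: rat_comb g l + u|) ->
  forall x, `|x| <= 1 ->
  exists T : {linear X -> X}, [/\ forall z, `|T z| <= `|z|,
    forall i, T (g i) = (1 - e) *: g i & T u = (1 - e) *: x].
Proof.
move=> e0 e1 u1 g0 far x x1.
pose G := [set p : X * X | exists v t, rat_span_closure g v /\
  p = (v + t *: u, (1 - e) *: (v + t *: x))].
have G0 : G 0.
  exists 0, 0; split; first exact: rat_span_closure0.
  by rewrite !scale0r addr0 scaler0.
have GP a p q : G p -> G q -> G (a *: p + q).
  move=> [v [t [vE ->]]] [w [s [wE ->]]]; exists (a *: v + w), (a * t + s).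
  split; first exact: rat_span_closureP.
  have E (z : X) : a *: v + w + (a * t + s) *: z =
      a *: (v + t *: z) + (w + s *: z).
    by rewrite scalerDl scalerDr -scalerA addrACA.
  rewrite !E; congr (_, _).
  by rewrite [RHS]/= [in RHS]scalerDr [in RHS]scalerA mulrC -scalerA scalerDr.
have Gle p : G p -> `|p.2| <= `|p.1|.
  move=> [v [t [vE ->]]] /=; rewrite normrZ ger0_norm ?subr_ge0//.
  apply: le_trans (far_rat_span_closure e0 e1 u1 g0 far t vE).
  rewrite ler_wpM2l ?subr_ge0//; apply: le_trans (ler_normD _ _) _.
  by rewrite lerD2l normrZ ler_piMr.
have [T [Tle TG]] := injective_extension injX (CRel G0 GP Gle).
exists T; split => // [i|].
  have /TG : G (g i, (1 - e) *: g i).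
    exists (g i), 0; split; first exact: rat_span_closure_gen.
    by rewrite !scale0r !addr0.
  exact.
have /TG : G (u, (1 - e) *: x).
  exists 0, 1; split; first exact: rat_span_closure0.
  by rewrite !scale1r !add0r.
exact.
Qed.

(** * Simultaneously far vectors in a slice *)

Section FarDirections.
Context (K : Type) (R : realType) (X : normedModType R).

(** The non-strict bound lets [e = 0] cover the perfect property. *)
Definition far_slices (e : R) : Prop :=
  forall A : set X, (A #<= [set: K])%card -> A `<=` @unit_sphere R X ->
  forall S : set X, is_slice S -> exists2 x, S x & forall y, A y ->
    2 - e <= `|y + x|.

Lemma daugavet_far_slices e : 0 < e -> daugavet K X -> far_slices e.
Proof.
move=> e0 dX A AK AS S sS; have [x Sx Ax] := dX A AK AS S sS e e0.
by exists x => // y /Ax/ltW.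
Qed.

Lemma perfect_daugavet_far_slices : perfect_daugavet K X -> far_slices 0.
Proof.
move=> dX A AK AS S sS; have [x Sx Ax] := dX A AK AS S sS.
by exists x => // y /Ax->; rewrite subr0.
Qed.

Lemma far_halfspace e (f : {linear X -> R^o}) (m : R) (x0 : X) (A : set X) :
  far_slices e -> continuous f -> `|x0| <= 1 -> m < f x0 ->
  (A #<= [set: K])%card -> A `<=` @unit_sphere R X ->
  exists u, [/\ `|u| <= 1, m < f u & forall y, A y -> 2 - e <= `|y + u|].
Proof.
move=> dX fc x01 mx0 AK AS.
have [M M0 fM] := continuous_linear_bound fc.
pose s := sup (f @` @closed_unit_ball R X).
have fs : f x0 <= s.
  apply: ub_le_sup; last by exists x0.
  exists M => _ [y /= y1 <-]; apply: le_trans (ler_norm _) _.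
  by apply: le_trans (fM y) _; rewrite ler_piMr// ltW.
have [|u [u1 mu] Au] := dX A AK AS (slice f (s - m)).
  by exists f, (s - m); split => //; rewrite subr_gt0 (lt_le_trans mx0).
by exists u; split => //; move: mu; rewrite opprB addrC subrK.
Qed.

(** All the directions together still number at most [K], so a single [u] serves every [i]. *)
Lemma far_direction (infK : infinite_set [set: K]) (I : Type) (A : set I)
    (g : I -> nat -> X) e (f : {linear X -> R^o}) (m : R) (x0 : X) :
  far_slices e -> continuous f -> `|x0| <= 1 -> m < f x0 ->
  (A #<= [set: K])%card ->
  exists u, [/\ `|u| <= 1, m < f u & forall i, A i ->
    forall l, rat_comb (g i) l != 0 ->
      2 - e <= `| `|rat_comb (g i) l|^-1 *: rat_comb (g i) l + u|].
Proof.
move=> dX fc x01 mx0 AK.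
(* Invalid codes and zero combinations give 0, which the intersection with the sphere discards. *)
pose h i n := let d := rat_comb (g i) (odflt [::] (unpickle n)) in `|d|^-1 *: d.
have := card_le_image2_nat infK h AK; set B := [set u | _] => BK.
have [| |u [u1 mu Bu]] :=
  @far_halfspace e f m x0 (B `&` @unit_sphere R X) dX fc x01 mx0.
- by apply: card_le_trans BK; apply: subset_card_le => x [].
- by move=> x [].
exists u; split => // i Ai l d0; apply: Bu; split; last exact: norm_normalize.
by exists i => //; exists (pickle l); rewrite /h pickleK.
Qed.

End FarDirections.

(** * Pure tensors and the projective norm *)

Section PureTensors.
Context (R : realType) (X Y : lmodType R).

Lemma pure_bilinear : bilinear_for *:%R *:%R (@pure R X Y).
Proof.
split=> u a x y; apply/val_inj/funext => b; rewrite linearP.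
  by rewrite /= /evalb /= linearPl.
by rewrite /= /evalb /= linearPr.
Qed.

HB.instance Definition _ := bilinear_isBilinear.Build R X Y (tensor X Y)
  *:%R *:%R (@pure R X Y) pure_bilinear.

End PureTensors.

Section PiNorm.
Context (R : realType) (X Y : normedModType R).

Lemma pi_norm_le (s : seq (X * Y)) :
  pi_norm (\sum_(p <- s) pure p.1 p.2) <= \sum_(p <- s) `|p.1| * `|p.2|.
Proof.
apply: ge_inf; last by exists s.
by exists 0 => _ [t _ ->]; apply: sumr_ge0 => p _; rewrite mulr_ge0.
Qed.

Lemma pi_norm_adherent (z : tensor X Y) e : 0 < e -> exists2 s : seq (X * Y),
  z = \sum_(p <- s) pure p.1 p.2
    & \sum_(p <- s) `|p.1| * `|p.2| < pi_norm z + e.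
Proof.
move=> e0; have [|_ [s zs ->] h] := @inf_adherent R
  [set r | exists2 s : seq (X * Y), z = \sum_(p <- s) pure p.1 p.2 &
     r = \sum_(p <- s) `|p.1| * `|p.2|] e e0; last by exists s.
split; first by have [s zs] := tensorP z;
  exists (\sum_(p <- s) `|p.1| * `|p.2|), s.
by exists 0 => _ [t _ ->]; apply: sumr_ge0 => p _; rewrite mulr_ge0.
Qed.

End PiNorm.

(** The universal property makes [T (x) S] well defined, so every representation of the source
    tensor transports to one of its image at no greater cost. *)
Lemma pi_norm_contraction (R : realType) (X Y X' Y' : normedModType R)
  (T : {linear X -> X'})
    (S : {linear Y -> Y'}) (s : seq (X * Y)) :
  (forall x, `|T x| <= `|x|) -> (forall y, `|S y| <= `|y|) ->
  pi_norm (\sum_(p <- s) pure (T p.1) (S p.2)) <=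
  pi_norm (\sum_(p <- s) pure p.1 p.2).
Proof.
move=> T1 S1;
  apply/ler_addgt0Pr => e /(pi_norm_adherent (\sum_(p <- s) pure p.1 p.2)).
move=> [t st /ltW]; apply: le_trans.
pose b x y := pure (T x) (S y).
have bP : bilinear_for *:%R *:%R b.
  by split=> u a x y; rewrite /b linearP ?linearPl ?linearPr.
pose B : {bilinear X -> Y -> tensor X' Y'} := HB.pack b
  (bilinear_isBilinear.Build _ _ _ _ _ _ b bP).
have [g gB _] := tensor_universal B.
have gE r : \sum_(p <- r) pure (T p.1) (S p.2) = g (\sum_(p <- r) pure p.1 p.2).
  by rewrite raddf_sum; apply: eq_bigr => p _; rewrite [RHS]gB.
rewrite gE st -gE.
have := pi_norm_le [seq (T p.1, S p.2) | p <- t];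
  rewrite !big_map => /le_trans; apply.
by apply: ler_sum => p _ /=; rewrite ler_pM.
Qed.

(** * Slices and averages in the completed tensor product *)

Section ProjectiveTensor.
Context (R : realType) (X Y : normedModType R) (P : completeNormedModType R).
Context (j : {linear tensor X Y -> P}) (projP : is_projective_tensor j).

Lemma norm_pure_le x y : `|j (pure x y)| <= `|x| * `|y|.
Proof. by have := pi_norm_le [:: (x, y)]; rewrite !big_seq1 projP.1. Qed.

Lemma projective_approx w e : 0 < e -> exists s : seq (X * Y),
  `|w - j (\sum_(p <- s) pure p.1 p.2)| < e /\
  \sum_(p <- s) `|p.1| * `|p.2| < `|w| + e.
Proof.
move=> e0; have e2 : 0 < e / 2 by rewrite divr_gt0.
have [_ [] /[swap] [[z _ <-]]] := projP.2 (ball w (e / 2))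
  (ex_intro _ w (ballxx _ e2)) (ball_open _ _).
rewrite -ball_normE /= => wz.
have [s zs] := pi_norm_adherent z e2; rewrite -projP.1 => se.
exists s; rewrite -zs; split; first by lra.
by have := ler_normD (j z - w) w; rewrite subrK distrC; lra.
Qed.

(* [f j(x (x) y) <= m] on unit vectors gives [f <= m] on the unit ball, so a
   slice of the ball of [P] meets the pure tensors. *)
Lemma pure_in_slice (f : {linear P -> R^o}) a : continuous f -> 0 < a ->
  exists x y, [/\ `|x| <= 1, `|y| <= 1 &
    sup (f @` @closed_unit_ball R P) - a < f (j (pure x y))].
Proof.
move=> fc a0; apply: contrapT => nex.
set m := sup _ - a in nex.
have fm x y : `|x| <= 1 -> `|y| <= 1 -> f (j (pure x y)) <= m.
  by move=> x1 y1; rewrite leNgt; apply/negP => ?; apply: nex; exists x, y.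
have m0 : 0 <= m.
  have := fm 0 0; rewrite !normr0 => /(_ ler01 ler01).
  by rewrite linear0l !linear0.
have fmul x y : f (j (pure x y)) <= m * (`|x| * `|y|).
  have [->|x0] := eqVneq x 0;
    first by rewrite linear0l !linear0 normr0 mul0r mulr0.
  have [->|y0] := eqVneq y 0; first by rewrite linear0r !linear0 normr0 !mulr0.
  have nx : 0 < `|x| by rewrite normr_gt0.
  have ny : 0 < `|y| by rewrite normr_gt0.
  have := fm (`|x|^-1 *: x) (`|y|^-1 *: y).
  rewrite !norm_normalize// lexx => /(_ isT isT).
  rewrite linearZl_LR linearZr_LR !linearZ /= /GRing.scale /=.
  by rewrite mulrA -invfM mulrC ler_pdivrMr ?mulr_gt0.
have [M M0 fM] := continuous_linear_bound fc.
have fw w : `|w| <= 1 -> f w <= m.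
  move=> w1; apply/ler_addgt0Pr => e e0.
  (* With [d = e / (M + m)], the approximation of [w] costs [M d] and the excess length of the
     representation [m d], in all [e]. *)
  have d0 : 0 < e / (M + m) by rewrite divr_gt0// ltr_wpDr.
  have [s [ws sl]] := projective_approx w d0.
  set z := j _ in ws.
  have -> : f w = f (w - z) + f z by rewrite -raddfD subrK.
  have fz : f z <= m * (1 + e / (M + m)).
    rewrite /z !raddf_sum;
      apply: le_trans (_ : _ <= m * \sum_(p <- s) `|p.1| * `|p.2|) _.
      by rewrite mulr_sumr; apply: ler_sum => p _; apply: fmul.
    by rewrite ler_wpM2l// (le_trans (ltW sl))// lerD2r.
  have fwz : f (w - z) <= M * (e / (M + m)).
    apply: le_trans (ler_norm _) _; apply: le_trans (fM _) _.
    by rewrite ler_wpM2l// ltW.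
  have -> : m + e = m + (M + m) * (e / (M + m)).
    by rewrite mulrCA divff ?mulr1// gt_eqF// ltr_wpDr.
  by rewrite mulrDl; lra.
have : sup (f @` @closed_unit_ball R P) <= m.
  apply: ge_sup; last by move=> _ [w w1 <-]; apply: fw.
  by exists (f 0), 0; rewrite /closed_unit_ball/= ?normr0.
by rewrite /m lerBrDr gerDl leNgt a0.
Qed.

(** By homogeneity [c | |x| |y| z + x (x) y |] is at most [|x| |y| B]. Summing over a representation
    of some [w] near [z], of total weight [L] near 1, gives [c |L z + w| <= L B], with left side
    near [2 c]. *)
Lemma pure_average z B c : `|z| = 1 -> 0 <= c ->
  (forall x y, `|x| <= 1 -> `|y| <= 1 -> c * `|z + j (pure x y)| <= B) ->
  2 * c <= B.
Proof.
move=> z1 c0 cB; have B0 : 0 <= B.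
  by apply: le_trans (cB 0 0 _ _); rewrite ?normr0// mulr_ge0.
have cBM x y : c * `|(`|x| * `|y|) *: z + j (pure x y)| <= (`|x| * `|y|) * B.
  have [->|x0] := eqVneq x 0.
    by rewrite linear0l linear0 normr0 mul0r scale0r addr0 normr0 mulr0 mul0r.
  have [->|y0] := eqVneq y 0.
    by rewrite linear0r linear0 normr0 mulr0 scale0r addr0 normr0 mulr0 mul0r.
  have nx : 0 < `|x| by rewrite normr_gt0.
  have ny : 0 < `|y| by rewrite normr_gt0.
  have := cB (`|x|^-1 *: x) (`|y|^-1 *: y).
  rewrite !norm_normalize// lexx =>
    /(_ isT isT) /(ler_wpM2l (ltW (mulr_gt0 nx ny))).
  rewrite mulrCA -[X in X * `|_ + _|]gtr0_norm ?mulr_gt0// -normrZ scalerDr.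
  rewrite linearZl_LR linearZr_LR !linearZ /= !scalerA.
  by rewrite mulrACA !mulVf ?gt_eqF// mulr1 scale1r.
apply/ler_addgt0Pr => e e0.
(* The losses will be [2 c d] on the left and [d B] on the right; the 1 keeps the denominator
   positive. *)
have d0 : 0 < e / (B + 2 * c + 1)
  by rewrite divr_gt0// ltr_wpDl// addr_ge0// mulr_ge0.
have [s [ws sl]] := projective_approx z d0; set d := _ / _ in d0 ws sl.
set L := \sum_(p <- s) _ in sl; set w := j _ in ws.
have LB : c * `|L *: z + w| <= L * B.
  rewrite /L /w !raddf_sum scaler_suml -big_split /= mulr_suml.
  apply: le_trans (_ : _ <= \sum_(p <- s)
    c * `|(`|p.1| * `|p.2|) *: z + j (pure p.1 p.2)|) _.
    by rewrite -mulr_sumr ler_wpM2l// ler_norm_sum.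
  by apply: ler_sum.
have wL : `|w| <= L by rewrite /w projP.1 pi_norm_le.
have L1 : 1 - d <= L.
  by have := ler_normD (z - w) w; rewrite subrK z1; lra.
(* Adding [z - w] to [L z + w] gives [(L + 1) z]. *)
have zw : L + 1 - d <= `|L *: z + w|.
  have := ler_normD (L *: z + w) (z - w).
  rewrite addrA addrAC addrK -[X in _ *: X + X]scale1r scalerA mulr1 -scalerDl.
  rewrite normrZ z1 mulr1 ger0_norm; first lra.
  by have := normr_ge0 w; lra.
have dE : d * (B + 2 * c + 1) = e.
  by rewrite /d divfK// gt_eqF// ltr_wpDl// addr_ge0// mulr_ge0.
have h1 : c * (2 - 2 * d) <= c * `|L *: z + w|.
  by rewrite ler_wpM2l//; lra.
have h2 : L * B <= (1 + d) * B by rewrite ler_wpM2r//; lra.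
lra.
Qed.

End ProjectiveTensor.

(** * Transfer of far vectors to the tensor product *)

(** Quantitative form of both parts: each of the two extensions loses a factor [1 - e]. *)
Lemma far_slices_projective_tensor (R : realType)
  (X Y : completeNormedModType R)
    (injX : injective_banach X) (injY : injective_banach Y)
    (K : Type) (infK : infinite_set [set: K])
    (P : completeNormedModType R) (j : {linear tensor X Y -> P})
    (projP : is_projective_tensor j) (e : R) :
  0 <= e -> e <= 1 -> far_slices K X e -> far_slices K Y e ->
  forall A : set P, (A #<= [set: K])%card -> A `<=` @unit_sphere R P ->
  forall S : set P, is_slice S ->
  exists2 w, S w & `|w| <= 1 /\ forall z, A z -> 2 * (1 - e) ^+ 2 <= `|z + w|.
Proof.
move=> e0 e1 dX dY A AK AS S [f [a [fc a0 ->]]].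
have [x0 [y0 [x01 y01 xy0]]] := pure_in_slice projP fc a0.
set m := sup _ - a in xy0.
have [M M0 fM] := continuous_linear_bound fc.
have fpure x y : `|f (j (pure x y))| <= M * (`|x| * `|y|).
  apply: le_trans (fM _) _; by rewrite (ler_wpM2l (ltW M0))// norm_pure_le.
have ex z : exists s : nat -> seq (X * Y), forall n,
    `|z - j (\sum_(p <- s n) pure p.1 p.2)| < n.+1%:R^-1.
  have /choice[s sP] : forall n : nat, exists s : seq (X * Y),
      `|z - j (\sum_(p <- s) pure p.1 p.2)| < n.+1%:R^-1.
    move=> n; have n0 : 0 < n.+1%:R^-1 :> R by rewrite invr_gt0.
    by have [s [zs _]] := projective_approx projP z n0; exists s.
  by exists s.
have [s sP] := choice ex.
(* Enumerates the pairs in all approximating sums of [z]; its two components generate [E_z] and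
   [F_z]. Out-of-range positions give the harmless pair [(0, 0)]. *)
pose coord z k := let q := odflt (0%N, 0%N) (unpickle k) in
  nth (0, 0) (s z q.1) q.2.
have coordP z n p : p \in s z n -> exists k, coord z k = p.
  move=> ps; exists (pickle (n, index p (s z n))).
  by rewrite /coord pickleK /= nth_index.
(* [l1_extension] needs a nonzero generator. If there were none, the sum of index 0 would vanish,
   yet it lies at distance less than 1 from the unit vector [z]. *)
have nz z : A z -> exists k, (coord z k).1 != 0 /\ (coord z k).2 != 0.
  move=> /AS; rewrite /unit_sphere/= => z1; apply: contrapT => nk.
  have s0 : \sum_(p <- s z 0%N) pure p.1 p.2 = 0.
    apply: big1_seq => p /= /coordP[k kp].
    have [p1|p1] := eqVneq p.1 0; first by rewrite p1 linear0l.
    have [p2|p2] := eqVneq p.2 0; first by rewrite p2 linear0r.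
    by exfalso; apply: nk; exists k; rewrite kp.
  by have := sP z 0%N; rewrite s0 linear0 subr0 z1 invr1 ltxx.
pose fX x : R^o := f (j (pure x y0)).
have fXlin : linear fX by move=> b x x'; rewrite /fX linearPl !linearP.
pose FX : {linear X -> R^o} :=
  HB.pack fX (GRing.isLinear.Build _ _ _ _ fX fXlin).
have lin_cont (V : normedModType R) (h : {linear V -> R^o}) :
    (forall x, `|h x| <= M * `|x|) -> continuous h.
  move=> hM; apply/bounded_linear_continuous/linear_boundedP.
  exists M; split; first exact: gtr0_real.
  by move=> N MN x; apply: le_trans (hM x) _; rewrite ler_wpM2r// ltW.
have FXc : continuous FX.
  apply: lin_cont => x; apply: le_trans (fpure _ _) _.
  by rewrite (ler_wpM2l (ltW M0))// ler_piMr.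
have [u [u1 mu uA]] := far_direction infK (fun z k =>
  (coord z k).1) dX FXc x01 xy0 AK.
(* By [mu], [y0] lies in the half-space cut out by this functional at level [m], so [v] can be
   chosen there too. *)
pose fY y : R^o := f (j (pure u y)).
have fYlin : linear fY by move=> b x x'; rewrite /fY linearPr !linearP.
pose FY : {linear Y -> R^o} :=
  HB.pack fY (GRing.isLinear.Build _ _ _ _ fY fYlin).
have FYc : continuous FY.
  apply: lin_cont => x; apply: le_trans (fpure _ _) _.
  by rewrite (ler_wpM2l (ltW M0))// ler_piMl.
have [v [v1 mv vA]] := far_direction infK (fun z k =>
  (coord z k).2) dY FYc y01 mu AK.
have uv1 : `|j (pure u v)| <= 1.
  by apply: le_trans (norm_pure_le projP _ _) _; rewrite mulr_ile1.
exists (j (pure u v)); first by split.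
split=> // z Az; have z1 : `|z| = 1 := AS _ Az.
have [k [k1 k2]] := nz _ Az.
apply: (pure_average projP z1); first by rewrite sqr_ge0.
move=> x y x1 y1.
have [T [T1 Tg Tu]] :=
  l1_extension injX e0 e1 u1 (ex_intro _ k k1) (uA _ Az) x1.
have [S' [S1 Sg Sv]] :=
  l1_extension injY e0 e1 v1 (ex_intro _ k k2) (vA _ Az) y1.
set c := (1 - e) ^+ 2.
have c0 : 0 <= c by rewrite sqr_ge0.
have c1 : c <= 1 by rewrite /c expr_le1// ?subr_ge0// gerBl.
apply/ler_addgt0Pr => d d0.
(* Replacing [z] by its approximation on both sides costs [c d / 2 + d / 2], at most [d]. *)
have [n nd] : exists n : nat, n.+1%:R^-1 < d / 2.
  have d2 : 0 < d / 2 by rewrite divr_gt0.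
  exists (Num.trunc (d / 2)^-1); rewrite invf_plt ?posrE//.
  by rewrite truncnS_gt.
set t := \sum_(p <- s z n) pure p.1 p.2.
have zt : `|z - j t| < d / 2 by apply: lt_trans (sP z n) nd.
(* [T (x) S'] carries [t + u (x) v] to [c (t + x (x) y)], because every factor in [t] is a
   coordinate of [z]. *)
have key : c * `|j t + j (pure x y)| <= `|j t + j (pure u v)|.
  rewrite ![j t + _]addrC.
  have := pi_norm_contraction ((u, v) :: s z n) T1 S1.
  rewrite !big_cons /= -/t Tu Sv -!projP.1 !raddfD /=.
  have -> : \sum_(p <- s z n) pure (T p.1) (S' p.2) = c *: t.
    rewrite /t scaler_sumr; apply: eq_big_seq => p /coordP[i <-].
    by rewrite Tg Sg linearZl_LR linearZr_LR /= scalerA -expr2.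
  rewrite linearZl_LR linearZr_LR /= scalerA -expr2 -/c !linearZ /=.
  by rewrite -scalerDr normrZ ger0_norm.
have := ler_normD (z - j t) (j t + j (pure x y)); rewrite addrA subrK => h1.
have := ler_normD (j t - z) (z + j (pure u v));
  rewrite addrA subrK distrC => h2.
have h3 : c * `|z + j (pure x y)| <= c * (`|z - j t| + `|j t + j (pure x y)|).
  by rewrite ler_wpM2l.
have h4 : c * `|z - j t| <= `|z - j t| by rewrite ler_piMl.
lra.
Qed.

Theorem theorem9p1 (R : realType) (X Y : completeNormedModType R)
    (injX : injective_banach X) (injY : injective_banach Y)
    (K : Type) (infK : infinite_set [set: K])
    (P : completeNormedModType R) (j : {linear tensor X Y -> P})
    (projP : is_projective_tensor j) :
  (daugavet K X -> daugavet K Y -> daugavet K P) /\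
  (perfect_daugavet K X -> perfect_daugavet K Y -> perfect_daugavet K P).
Proof.
split=> dX dY A AK AS S sS.
  (* As [2 (1 - d)^2 >= 2 - 4 d], taking [d <= e / 8] leaves at least [2 - e / 2]. *)
  move=> e e0; pose d := Num.min (e / 8) 1.
  have d0 : 0 < d by rewrite lt_min divr_gt0//=.
  have d1 : d <= 1 by rewrite ge_min lexx orbT.
  have de : d <= e / 8 by rewrite ge_min lexx.
  have [w Sw [_ wA]] :=
    far_slices_projective_tensor injX injY infK projP (ltW d0) d1
    (daugavet_far_slices d0 dX) (daugavet_far_slices d0 dY) AK AS sS.
  exists w => // z /wA; apply: lt_le_trans.
  by have := sqr_ge0 d; rewrite expr2; nra.
have [w Sw [w1 wA]] :=
  far_slices_projective_tensor injX injY infK projP (lexx 0) ler01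
  (perfect_daugavet_far_slices dX) (perfect_daugavet_far_slices dY) AK AS sS.
exists w => // z Az; apply/eqP; rewrite eq_le; apply/andP; split.
  by have := ler_normD z w; rewrite (AS _ Az); lra.
by have := wA _ Az; rewrite subr0 expr1n mulr1.
Qed.
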